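(* Let $1\le q<p,r<\infty$, let $\lambda_j\ge 0$, $j=0,1,\ldots,n$, and put $\sigma_r(t)=\sum_{j=1}^n\lambda_j|\varphi_j(t)|^r$. Assume that $\lambda_0+\sigma_r(t)\ne0$ for almost all $t\in T_0$ and $\sigma_r(t)\ne0$ for almost all $t\in T\setminus T_0$. Let $\widehat x(t)\ge0$ be a solution of the equation $$-q|\psi(t)|^q+p\lambda_0x^{p-q}(t)\chi_0(t)+r\sigma_r(t)x^{r-q}(t)=0,$$ where $\chi_0(t)=1$ for $t\in T_0$ and $\chi_0(t)=0$ for $t\notin T_0$, and suppose that $(\lambda_0,\ldots,\lambda_n)$ is such that $$\int_{T_0}\widehat x^p(t)\,d\mu(t)\le\delta^p,\qquad \int_T|\varphi_j(t)|^r\widehat x^r(t)\,d\mu(t)\le1,\quad j=1,\ldots,n,$$ $$\lambda_0\Bigl(\int_{T_0}\widehat x^p(t)\,d\mu(t)-\delta^p\Bigr)=0,\qquad \lambda_j\Bigl(\int_T|\varphi_j(t)|^r\widehat x^r(t)\,d\mu(t)-1\Bigr)=0,\quad j=1,\ldots,n.$$ Then $$E(p,q,r)=\Bigl(q^{-1}p\lambda_0\delta^p+q^{-1}r\sum_{j=1}^n\lambda_j\Bigr)^{1/q},$$ and the method $$\widehat m(y)(t)=\begin{cases}q^{-1}p\lambda_0\widehat x^{p-q}(t)|\psi(t)|^{-q}\psi(t)y(t),&t\in T_0,\ \psi(t)\ne0,\\ 0,&\text{otherwise},\end{cases}$$ is an optimal recovery method.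
   Context: $(T,\Sigma,\mu)$ is a nonempty set with a $\sigma$-algebra $\Sigma$ and a nonnegative $\sigma$-additive measure $\mu$; $L_p(T,\mu)$ denotes the $\Sigma$-measurable functions with values in $\mathbb R$ or $\mathbb C$ with finite norm $\|x\|_{L_p(T,\mu)}=(\int_T|x|^p\,d\mu)^{1/p}$ (essential supremum for $p=\infty$). $T_0\subset T$ is a nonempty $\mu$-measurable subset, $\psi,\varphi_1,\ldots,\varphi_n$ are measurable functions on $T$, and $\delta>0$. Put $$\mathcal W=\{x:\ x\in L_p(T_0,\mu),\ \|\varphi_jx\|_{L_r(T,\mu)}<\infty,\ j=1,\ldots,n\},\quad W=\{x\in\mathcal W:\ \|\varphi_jx\|_{L_r(T,\mu)}\le1,\ j=1,\ldots,n\}$$ (here $x$ is a measurable function on $T$). It is assumed that $\Lambda x:=\psi x\in L_q(T,\mu)$ for all $x\in\mathcal W$. A recovery method is an arbitrary map $m\colon L_p(T_0,\mu)\to L_q(T,\mu)$; its error is $$e(p,q,r,m)=\sup\{\|\Lambda x-m(y)\|_{L_q(T,\mu)}:\ x\in W,\ y\in L_p(T_0,\mu),\ \|x-y\|_{L_p(T_0,\mu)}\le\delta\}.$$ The optimal recovery error is $E(p,q,r)=\inf_m e(p,q,r,m)$ over all methods $m$, and a method attaining this infimum is called optimal. *)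

(* Defs.v *)
From HB Require Import structures.
From mathcomp Require Import all_boot all_order all_algebra.
From mathcomp Require Import complex.
From mathcomp Require Import all_classical all_reals all_analysis.
Set Implicit Arguments.
Unset Strict Implicit.
Unset Printing Implicit Defensive.
Import Order.TTheory GRing.Theory Num.Theory.
Import numFieldNormedType.Exports.
Local Open Scope classical_set_scope.
Local Open Scope ring_scope.

(* The functions under consideration take values in one fixed scalar field,
   which is either the reals or the complex numbers. *)
Variant scalar_kind := RealScalars | ComplexScalars.

Definition scalar_field (R : realType) (s : scalar_kind) : numFieldType :=
  match s with RealScalars => R | ComplexScalars => R[i]%C end.

(* The norm of R[i] in MathComp is itself valued in R[i], hence the [Re]. *)
Definition sabs (R : realType) (s : scalar_kind) : scalar_field R s -> R :=
  match s return scalar_field R s -> R with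
  | RealScalars => fun x : R => `|x|
  | ComplexScalars => fun z : R[i]%C => complex.Re `|z|
  end.

Definition sreal (R : realType) (s : scalar_kind) : R -> scalar_field R s :=
  match s return R -> scalar_field R s with
  | RealScalars => fun x => x
  | ComplexScalars => fun x => (x%:C)%C
  end.

Section recovery.
Context (d : measure_display) (T : measurableType d) (R : realType)
        (s : scalar_kind) (mu : {measure set T -> \bar R}).
Local Notation K := (scalar_field R s).

Definition smeasurable : (T -> K) -> Prop :=
  match s return (T -> scalar_field R s) -> Prop with
  | RealScalars => fun f : T -> R => measurable_fun [set: T] f
  | ComplexScalars => fun f : T -> R[i]%C =>
      measurable_fun [set: T] (fun t => complex.Re (f t)) /\
      measurable_fun [set: T] (fun t => complex.Im (f t))
  end.

Definition Lpnorm (D : set T) (p : R) (f : T -> K) : \bar R :=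
  'N[mu]_(p%:E)[(fun t => (sabs (f t))%:E) \_ D]%E.

(* Functions on [D] are represented by their extension by zero to the whole
   space; for measurable [D] this is a bijection that preserves measurability
   and the norm. *)
Definition Lp (D : set T) (p : R) : set (T -> K) :=
  [set f | [/\ smeasurable f, forall t, ~ D t -> f t = 0
             & (Lpnorm D p f < +oo)%E]].

Context (T0 : set T) (n : nat) (psi : T -> K) (phi : 'I_n -> T -> K).

(* [patch (fun=> 0) T0 x] is the restriction of [x] to [T0]. *)
Definition calW (p r : R) : set (T -> K) :=
  [set x | [/\ smeasurable x, Lp T0 p (patch (fun=> 0) T0 x)
             & forall j, (Lpnorm [set: T] r (fun t => phi j t * x t)%R
                            < +oo)%E]].

Definition W (p r : R) : set (T -> K) :=
  [set x | calW p r x /\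
     forall j, (Lpnorm [set: T] r (fun t => phi j t * x t)%R <= 1)%E].

Definition Lambda (x : T -> K) : T -> K := fun t => psi t * x t.

(* A method is an arbitrary map from L_p(T0) to L_q(T); the values of [m]
   outside of [Lp T0 p] are never used. *)
Definition recovery_method (p q : R) (m : (T -> K) -> T -> K) : Prop :=
  set_fun (Lp T0 p) (Lp [set: T] q) m.

Definition recovery_error (delta p q r : R) (m : (T -> K) -> T -> K) :
    \bar R :=
  ereal_sup [set z | exists x y, [/\ W p r x, Lp T0 p y,
     (Lpnorm T0 p (fun t => x t - y t)%R <= delta%:E)%E
     & z = Lpnorm [set: T] q (fun t => Lambda x t - m y t)]].

Definition optimal_error (delta p q r : R) : \bar R :=
  ereal_inf [set recovery_error delta p q r m | m in recovery_method p q].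

Definition optimal_method (delta p q r : R) (m : (T -> K) -> T -> K) : Prop :=
  recovery_method p q m /\
  recovery_error delta p q r m = optimal_error delta p q r.

Definition sigma_r (r : R) (lam : 'I_n -> R) (t : T) : R :=
  \sum_(j < n) lam j * sabs (phi j t) `^ r.

Definition mhat (p q lam0 : R) (xh : T -> R) (y : T -> K) (t : T) : K :=
  if (t \in T0) && (psi t != 0) then
    sreal s (q^-1 * p * lam0 * xh t `^ (p - q) * sabs (psi t) `^ (- q))
      * psi t * y t
  else 0.

End recovery.

(* Main.v *)
(* Write M = |psi|^q = P + S, where P and S are the two other terms of the
   equation for xh divided by q (P vanishes off T0), and c = P / M.  On T0,
   psi x - mhat(y) = psi ((1 - c) x + c (x - y)), so convexity of |.|^q bounds
   |psi x - mhat(y)|^q by S |x|^q + P |x - y|^q.  The weighted Young inequality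
   xh^(p-q) |z|^q <= (p-q)/p xh^p + q/p |z|^p and its analogue for r bound the
   integral by the claimed value.  Conversely xh and -xh both lie in W and are
   compatible with the datum y = 0, so by convexity no method does better than
   the norm of psi xh, which complementary slackness evaluates.

   On the null set where the equation degenerates xh is arbitrary, and perhaps
   not measurable; there it is replaced by 0, which changes neither the
   integrals nor mhat. *)
Require Import Defs.
From HB Require Import structures.
From mathcomp Require Import all_boot all_order all_algebra.
From mathcomp Require Import complex.
From mathcomp Require Import all_classical all_reals all_analysis.
From mathcomp Require Import measurable_realfun ring lra.
Import Order.TTheory GRing.Theory Num.Theory.
Import numFieldNormedType.Exports HBNNSimple.
Local Open Scope classical_set_scope.
Local Open Scope ring_scope.
Set Implicit Arguments.
Unset Strict Implicit.
Unset Printing Implicit Defensive.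

(** * Young's inequality and convexity for real powers *)

Section real_powers.
Context {R : realType}.
Implicit Types a b c p q : R.

Lemma powRB_mul a p q : 0 <= a -> q < p -> 0 < q ->
  a `^ (p - q) * a `^ q = a `^ p.
Proof.
move=> a0 qp q0; rewrite -powRD ?subrK//.
by rewrite gt_eqF// (lt_trans q0).
Qed.

(** Young's inequality for [a ^ (p - q)] and [b ^ q] with the conjugate exponents [p / (p - q)] and
    [p / q], which turn both factors into [p]-th powers. *)
Lemma young_powR a b p q : 0 <= a -> 0 <= b -> 0 < q -> q < p ->
  a `^ (p - q) * b `^ q <= (p - q) / p * a `^ p + q / p * b `^ p.
Proof.
move=> a0 b0 q0 qp.
have p0 : 0 < p by exact: lt_trans qp.
have pq0 : 0 < p - q by rewrite subr_gt0.
have pN0 : p != 0 by rewrite gt_eqF.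
have qN0 : q != 0 by rewrite gt_eqF.
have pqN0 : p - q != 0 by rewrite gt_eqF.
have := @conjugate_powR R (a `^ (p - q)) (b `^ q) (p / (p - q)) (p / q)
  (powR_ge0 _ _) (powR_ge0 _ _) (divr_gt0 p0 pq0) (divr_gt0 p0 q0).
rewrite -!powRrM !invf_div.
rewrite (_ : (p - q) * (p / (p - q)) = p); last by field.
rewrite (_ : q * (p / q) = p); last by field.
rewrite (mulrC (a `^ p)) (mulrC (b `^ p)); apply.
by field.
Qed.

Lemma powR_convex_le c a b q : 1 <= q -> 0 <= c -> c <= 1 -> 0 <= a -> 0 <= b ->
  ((1 - c) * a + c * b) `^ q <= (1 - c) * a `^ q + c * b `^ q.
Proof.
move=> q1 c0 c1 a0 b0.
(* Convexity of the power function is stated for weights in the interval type of [0, 1], so [c] is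
   packed into that type. *)
have c01 : Itv.spec (@Itv.num_sem R) (Itv.Real `[0%Z, 1%Z]) c.
  by rewrite /Itv.spec/= /Itv.num_sem/= num_real/= in_itv/= c0 c1.
have := @convex_powR R q q1 (Itv.mk c01) b a.
rewrite !convRE/= /unstable.onem => h.
rewrite addrC (addrC (_ * a `^ q)); apply: h;
  by rewrite inE/= in_itv/= andbT.
Qed.

End real_powers.

(** * Modulus and measurability for real or complex scalars *)

Lemma sabs_complex (R : realType) (z : R[i]%C) :
  @sabs R ComplexScalars z = Num.sqrt (complex.Re z ^+ 2 + complex.Im z ^+ 2).
Proof. by case: z. Qed.

Section scalars.
Context {R : realType} {s : scalar_kind}.
Local Notation K := (scalar_field R s).
Implicit Types x y : K.

Lemma sabs_ge0 x : 0 <= sabs x.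
Proof.
case: s x => x; first exact: normr_ge0.
by rewrite sabs_complex sqrtr_ge0.
Qed.

Lemma sabs0 : sabs (0 : K) = 0.
Proof.
case: s; first exact: normr0.
by rewrite sabs_complex/= expr0n/= addr0 sqrtr0.
Qed.

Lemma sabs_eq0 x : (sabs x == 0) = (x == 0).
Proof.
case: s x => [x|]; first exact: normr_eq0.
case=> a b; transitivity ((a == 0) && (b == 0)); last first.
  by apply/esym; exact: (eq_complex (a +i* b)%C 0%C).
rewrite sabs_complex/= sqrtr_eq0.
rewrite -(sqrf_eq0 a) -(sqrf_eq0 b) -paddr_eq0 ?sqr_ge0//.
by rewrite eq_le (addr_ge0 (sqr_ge0 _) (sqr_ge0 _)) andbT.
Qed.

Lemma sabsM x y : sabs (x * y) = sabs x * sabs y.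
Proof.
case: s x y => [x y|]; first exact: normrM.
move=> [a b] [a' b']; rewrite !sabs_complex/=.
by rewrite -sqrtrM ?addr_ge0 ?sqr_ge0//; congr Num.sqrt; ring.
Qed.

Lemma sabsD x y : sabs (x + y) <= sabs x + sabs y.
Proof.
case: s x y => [x y|x y]; first exact: ler_normD.
(* The order of [R[i]] requires equal imaginary parts and compares real parts; only the comparison
   is kept. *)
have := @ler_normD R[i]%C R[i]%C x y; rewrite lecE => /andP[_].
by case: x y => [a b] [a' b'].
Qed.

Lemma sabsN x : sabs (- x) = sabs x.
Proof.
case: s x => [x|[a b]]; first exact: normrN.
by rewrite !sabs_complex/= !sqrrN.
Qed.

Lemma sabsB x y : sabs (x - y) <= sabs x + sabs y.
Proof. by rewrite -(sabsN y) sabsD. Qed.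

Lemma sabs_real (a : R) : sabs (sreal s a) = `|a|.
Proof.
case: s => //.
by rewrite sabs_complex/= expr0n/= addr0 sqrtr_sqr.
Qed.

Lemma sreal0 : sreal s (0 : R) = 0.
Proof. by case: s. Qed.

Lemma sreal1 : sreal s (1 : R) = 1.
Proof. by case: s. Qed.

Lemma srealB (a b : R) : sreal s (a - b) = sreal s a - sreal s b.
Proof. by case: s => //=; exact: rmorphB. Qed.

Context {d : measure_display} {T : measurableType d}.
Implicit Types f g : T -> K.

Lemma measurable_sabs f : smeasurable f ->
  measurable_fun [set: T] (fun t => sabs (f t)).
Proof.
case: s f => [f mf|f [mr mi]]; first exact: measurableT_comp.
under eq_fun do rewrite sabs_complex.
apply: measurableT_comp => //.
  exact: continuous_measurable_fun (@sqrt_continuous R).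
by apply: measurable_funD; apply: measurable_funX.
Qed.

Lemma smeasurable_real (a : T -> R) : measurable_fun [set: T] a ->
  smeasurable (fun t => sreal s (a t)).
Proof. by case: s. Qed.

Lemma smeasurable0 : smeasurable (fun _ : T => 0 : K).
Proof. by case: s; [|split]; exact: measurable_cst. Qed.

Lemma smeasurableM f g : smeasurable f -> smeasurable g ->
  smeasurable (fun t => f t * g t).
Proof.
case: s f g => f g /= => [mf mg|[mrf mif] [mrg mig]].
  exact: measurable_funM.
split.
- rewrite (_ : (fun t => _) = (fun t => complex.Re (f t) * complex.Re (g t)
     - complex.Im (f t) * complex.Im (g t))).
    by apply: measurable_funB; apply: measurable_funM.
  by apply/funext => t; case: (f t) => ? ?; case: (g t).
- rewrite (_ : (fun t => _) = (fun t => complex.Re (f t) * complex.Im (g t)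
     + complex.Im (f t) * complex.Re (g t))).
    by apply: measurable_funD; apply: measurable_funM.
  by apply/funext => t; case: (f t) => ? ?; case: (g t).
Qed.

Lemma smeasurableB f g : smeasurable f -> smeasurable g ->
  smeasurable (fun t => f t - g t).
Proof.
case: s f g => f g /= => [mf mg|[mrf mif] [mrg mig]].
  exact: measurable_funB.
split.
- rewrite (_ : (fun t => _) = (fun t => complex.Re (f t) - complex.Re (g t))).
    exact: measurable_funB.
  by apply/funext => t; case: (f t) => ? ?; case: (g t).
- rewrite (_ : (fun t => _) = (fun t => complex.Im (f t) - complex.Im (g t))).
    exact: measurable_funB.
  by apply/funext => t; case: (f t) => ? ?; case: (g t).
Qed.

(** Written as a product with an indicator, a restriction is measurable by [smeasurableM]. *)
Lemma patch_sreal (D : set T) f :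
  patch (fun=> 0) D f = (fun t => sreal s (\1_D t) * f t).
Proof.
apply/funext => t; rewrite patchE indicE.
by case: ifP => _; rewrite ?sreal1 ?mul1r// sreal0 mul0r.
Qed.

End scalars.

(** * Integrals modulo null sets, and norms as integrals of powers *)

Section integrals.
Context {d : measure_display} {T : measurableType d} {R : realType}.
Context (mu : {measure set T -> \bar R}).
Local Open Scope ereal_scope.

(* [f] may fail to be measurable here: the simple functions below [f] only see
   its values on [A]. *)
Lemma integral_conull (A : set T) (f : T -> \bar R) : measurable A ->
  mu (~` A) = 0 -> (forall t, 0 <= f t) -> \int[mu]_t f t = \int[mu]_(t in A) f t.
Proof.
move=> mA muA f0; rewrite [RHS]integral_mkcond.
have fA0 t : 0 <= (f \_ A) t by rewrite patchE; case: ifP.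
apply/eqP; rewrite eq_le !ge0_integralTE//; apply/andP; split.
  (* A simple function [h] below [f], cut off outside [A], lies below the restriction of [f]; its
     integral does not change because the complement of [A] is null. *)
  apply: ge_ereal_sup => _ [h hf <-].
  have hA t : proj_nnsfun h mA t = (if t \in A then h t else 0)%R.
    by rewrite -mrestrict patchE.
  apply: ereal_sup_ubound; exists (proj_nnsfun h mA).
    by move=> t; rewrite hA patchE; case: ifP => // _; exact: hf.
  rewrite -!integralT_nnsfun.
  have mh : measurable_fun [set: T] (EFin \o h) by exact/measurable_EFinP.
  rewrite (_ : \int[mu]_t (proj_nnsfun h mA t)%:E = \int[mu]_(t in A) (h t)%:E).
    have := @ge0_negligible_integral _ _ _ mu setT (~` A) _
      (measurableC mA) measurableT mh _ muA.
    by rewrite setTD setCK => -> // t _; rewrite lee_fin.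
  rewrite [RHS]integral_mkcond; apply: eq_integral => t _.
  by rewrite hA patchE; case: ifP.
(* Conversely, a simple function below the restriction is already below [f], since [f] is
   nonnegative. *)
apply: le_ereal_sup => _ [h hf <-]; exists h => // t.
by apply: le_trans (hf t) _; rewrite patchE; case: ifP.
Qed.

(** Neither function has to be measurable: this carries the integral conditions on [xh] over to its
    modification on a null set. *)
Lemma eq_integral_conull (A D : set T) (f g : T -> \bar R) : measurable A ->
  mu (~` A) = 0 -> (forall t, 0 <= f t) -> (forall t, 0 <= g t) ->
  (forall t, A t -> f t = g t) -> \int[mu]_(t in D) f t = \int[mu]_(t in D) g t.
Proof.
move=> mA muA f0 g0 fg; rewrite (integral_mkcond D f) (integral_mkcond D g).
rewrite !(integral_conull mA muA).
- apply: eq_integral => t /set_mem At.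
  by rewrite !patchE; case: ifP => // _; exact: fg.
- by move=> t; rewrite patchE; case: ifP.
- by move=> t; rewrite patchE; case: ifP.
Qed.

Lemma integralZ_EFin (D : set T) (k : R) (f : T -> R) : measurable D ->
  measurable_fun D f -> (0 <= k)%R -> (forall t, D t -> (0 <= f t)%R) ->
  \int[mu]_(t in D) (k * f t)%:E = k%:E * \int[mu]_(t in D) (f t)%:E.
Proof.
move=> mD mf k0 f0; under eq_integral do rewrite EFinM.
by rewrite ge0_integralZl_EFin//; exact/measurable_EFinP.
Qed.

Lemma integralD_EFin (D : set T) (f g : T -> R) : measurable D ->
  measurable_fun D f -> measurable_fun D g ->
  (forall t, D t -> (0 <= f t)%R) -> (forall t, D t -> (0 <= g t)%R) ->
  \int[mu]_(t in D) (f t + g t)%:E =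
    \int[mu]_(t in D) (f t)%:E + \int[mu]_(t in D) (g t)%:E.
Proof.
move=> mD mf mg f0 g0; under eq_integral do rewrite EFinD.
by rewrite ge0_integralD//; exact/measurable_EFinP.
Qed.

Lemma integral_sum_EFin (n : nat) (k : 'I_n -> R) (f : 'I_n -> T -> R) :
  (forall j, measurable_fun [set: T] (f j)) -> (forall j, (0 <= k j)%R) ->
  (forall j t, (0 <= f j t)%R) ->
  \int[mu]_t (\sum_(j < n) k j * f j t)%:E =
    \sum_(j < n) (k j)%:E * \int[mu]_t (f j t)%:E.
Proof.
move=> mf k0 f0.
under eq_integral do rewrite -sumEFin.
rewrite ge0_integral_sum//.
- by apply: eq_bigr => j _; rewrite integralZ_EFin.
- by move=> j; apply/measurable_EFinP; exact: measurable_funM.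
- by move=> j t _; rewrite lee_fin mulr_ge0.
Qed.

Lemma integral_indicM (D : set T) (f : T -> R) :
  \int[mu]_t (\1_D t * f t)%:E = \int[mu]_(t in D) (f t)%:E.
Proof.
rewrite [RHS]integral_mkcond; apply: eq_integral => t _.
by rewrite patchE indicE; case: ifP => _; rewrite ?mul1r ?mul0r.
Qed.

(** The two bounds make [I] finite, so complementary slackness becomes an equation between reals. *)
Lemma slack_mule (l c : R) (I : \bar R) : 0 <= I -> I <= c%:E ->
  l%:E * (I - c%:E) = 0 -> l%:E * I = (l * c)%:E.
Proof.
case: I => [i| |]//= _ _; rewrite -EFinB -!EFinM => -[h].
by congr EFin; lra.
Qed.

Context {s : scalar_kind}.
Implicit Types f : T -> scalar_field R s.

Lemma LpnormE (D : set T) (p : R) f : (0 < p)%R ->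
  Lpnorm mu D p f = (\int[mu]_(t in D) (sabs (f t) `^ p)%:E) `^ p^-1.
Proof.
move=> p0; rewrite /Lpnorm unlock [in RHS]integral_mkcond.
congr (_ `^ _); apply: eq_integral => t _.
rewrite !patchE; case: ifP => _; last by rewrite abse0 poweR0r// gt_eqF.
by rewrite gee0_abs ?lee_fin ?sabs_ge0// poweR_EFin.
Qed.

(** With [Lpnorm_lty], this lets the estimates be carried out on integrals of powers; it rests on
    the monotonicity of the powers [p] and [p^-1]. *)
Lemma Lpnorm_le (D : set T) (p c : R) f : (0 < p)%R -> (0 <= c)%R ->
  (Lpnorm mu D p f <= c%:E) =
  (\int[mu]_(t in D) (sabs (f t) `^ p)%:E <= (c `^ p)%:E).
Proof.
move=> p0 c0; rewrite LpnormE//.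
set I := \int[mu]_(t in D) _.
have I0 : 0 <= I by apply: integral_ge0 => t _; rewrite lee_fin powR_ge0.
have IE : (I `^ p^-1) `^ p = I.
  by rewrite -poweRrM mulVf ?gt_eqF// poweRe1.
apply/idP/idP => h.
- rewrite -IE -poweR_EFin; apply: gt0_ler_poweR => //; first exact: ltW.
  + by rewrite in_itv/= poweR_ge0 leey.
  + by rewrite in_itv/= lee_fin c0 leey.
- have -> : c%:E = (c `^ p)%:E `^ p^-1.
    by rewrite poweR_EFin -powRrM mulfV ?gt_eqF// powRr1.
  apply: gt0_ler_poweR => //; first by rewrite invr_ge0 ltW.
  + by rewrite in_itv/= I0 leey.
  + by rewrite in_itv/= lee_fin powR_ge0 leey.
Qed.

Lemma Lpnorm_lty (D : set T) (p : R) f : (0 < p)%R ->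
  (Lpnorm mu D p f < +oo) = (\int[mu]_(t in D) (sabs (f t) `^ p)%:E < +oo).
Proof.
move=> p0; rewrite LpnormE//; apply/idP/idP; last exact: poweR_lty.
by apply: lty_poweRy; rewrite invr_neq0// gt_eqF.
Qed.

Lemma Lpnorm_ge0 (D : set T) (p : R) f : 0 <= Lpnorm mu D p f.
Proof. exact: Lnorm_ge0. Qed.

End integrals.

(** For [c >= 0], strict monotonicity makes [xh t > c] on [A] equivalent to [F c t < m t], a
    condition free of [xh], so superlevel sets are measurable. For [c < 0] the superlevel set is the
    whole space, as the function is nonnegative. *)
Lemma measurable_root (d : measure_display) (T : measurableType d)
    (R : realType) (A : set T) (F : R -> T -> R) (m xh : T -> R) :
  measurable A -> measurable_fun [set: T] m ->
  (forall c, measurable_fun [set: T] (F c)) ->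
  (forall t, 0 <= xh t) -> (forall t, A t -> F (xh t) t = m t) ->
  (forall t a b, A t -> 0 <= a -> a < b -> F a t < F b t) ->
  measurable_fun [set: T] (fun t => \1_A t * xh t).
Proof.
move=> mA mm mF xh0 Fxh Finc mT.
apply: (measurability _ (RGenOInfty.measurableE R)) => //.
move=> _ [_ [c ->] <-]; rewrite setTI.
have [c0|c0] := ltP c 0.
  rewrite (_ : _ @^-1` _ = setT)//; apply/seteqP; split => // t _ /=.
  by rewrite in_itv/= andbT (lt_le_trans c0)// mulr_ge0// indicE ler0n.
rewrite (_ : _ @^-1` _ = A `&` ~` [set t | m t <= F c t]).
  apply: measurableI => //; apply: measurableC.
  by rewrite -[X in measurable X]setTI; exact: measurable_fun_le.
apply/seteqP; split => t /=; rewrite in_itv/= andbT indicE.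
- case: (boolP (t \in A)) => [/set_mem At|_]; last by rewrite mul0r ltNge c0.
  rewrite mul1r => cx; split=> //; apply/negP; rewrite -ltNge -(Fxh t)//.
  exact: Finc.
- move=> [At /negP]; rewrite -ltNge mem_set// mul1r => cm.
  rewrite ltNge; apply/negP => xc.
  suff : m t <= F c t by rewrite leNgt cm.
  move: xc; rewrite -(Fxh t)// le_eqVlt => /predU1P[->//|xc].
  by rewrite ltW// Finc.
Qed.

(** * The equation for [xh] and pointwise estimates *)

Section recovery.
Context {d : measure_display} {T : measurableType d} {R : realType}
  {s : scalar_kind} (mu : {measure set T -> \bar R}).
Context (T0 : set T) (mT0 : measurable T0) (n : nat)
  (psi : T -> scalar_field R s) (phi : 'I_n -> T -> scalar_field R s)
  (mpsi : smeasurable psi) (mphi : forall j, smeasurable (phi j)).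
Context (delta : R) (delta_gt0 : 0 < delta)
  (p q r : R) (q_ge1 : 1 <= q) (qp : q < p) (qr : q < r)
  (lam0 : R) (lam : 'I_n -> R)
  (lam0_ge0 : 0 <= lam0) (lam_ge0 : forall j, 0 <= lam j).
Local Notation sigma := (sigma_r phi r lam).
(** One condition for both regions: the indicator leaves [lam0 + sigma t] on [T0] and [sigma t]
    elsewhere. *)
Local Notation nondeg t := (lam0 * \1_T0 t + sigma t != 0).

Let q_gt0 : 0 < q. Proof. exact: lt_le_trans q_ge1. Qed.
Let p_gt0 : 0 < p. Proof. exact: lt_trans qp. Qed.
Let r_gt0 : 0 < r. Proof. exact: lt_trans qr. Qed.
Let p0_ge0 : 0 <= q^-1 * p * lam0.
Proof. by rewrite !mulr_ge0// ?invr_ge0 ltW. Qed.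
Let r0_ge0 : 0 <= q^-1 * r.
Proof. by rewrite mulr_ge0// ?invr_ge0 ltW. Qed.

Lemma sigma_ge0 t : 0 <= sigma t.
Proof. by apply: sumr_ge0 => j _; rewrite mulr_ge0// powR_ge0. Qed.

Lemma measurable_sabs_powR (f : T -> scalar_field R s) (a : R) (D : set T) :
  smeasurable f -> measurable_fun D (fun t => sabs (f t) `^ a).
Proof.
move=> mf; apply: measurable_funTS.
exact: (measurableT_comp (measurable_powR a) (measurable_sabs mf)).
Qed.

Lemma measurable_powR_comp (f : T -> R) (a : R) (D : set T) :
  measurable_fun [set: T] f -> measurable_fun D (fun t => f t `^ a).
Proof.
move=> mf; apply: measurable_funTS.
exact: (measurableT_comp (measurable_powR a) mf).
Qed.

Lemma measurable_sigma : measurable_fun [set: T] sigma.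
Proof.
apply: measurable_sum => j; apply: measurable_funM => //.
exact: measurable_sabs_powR.
Qed.

Lemma measurable_nondeg : measurable [set t | nondeg t].
Proof.
rewrite (_ : [set t | _] = (fun t => lam0 * \1_T0 t + sigma t) @^-1` (~` [set 0])).
  rewrite -[X in measurable X]setTI.
  have : measurable_fun setT (fun t => lam0 * \1_T0 t + sigma t).
    apply: measurable_funD; last exact: measurable_sigma.
    by apply: measurable_funM => //; exact: measurable_indic.
  by apply => //; exact: measurableC.
by apply/seteqP; split => t /= /eqP.
Qed.

Context (xh : T -> R) (xh_ge0 : forall t, 0 <= xh t)
  (xh_sol : forall t, nondeg t ->
     - q * sabs (psi t) `^ q + p * lam0 * xh t `^ (p - q) * \1_T0 t
       + r * sigma t * xh t `^ (r - q) = 0).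

Lemma psi_split t : nondeg t ->
  sabs (psi t) `^ q = q^-1 * p * lam0 * (\1_T0 t * xh t `^ (p - q))
    + q^-1 * r * (sigma t * xh t `^ (r - q)).
Proof.
move=> /xh_sol h; have qN0 : q != 0 by rewrite gt_eqF.
by apply: (mulfI qN0); rewrite mulrDr !mulrA divff//; lra.
Qed.

(** At a nondegenerate point one of the nonnegative coefficients of the equation is positive, and
    the exponents [p - q] and [r - q] are positive, so the equation is strictly increasing in its
    unknown and [measurable_root] applies. *)
Lemma measurable_solution :
  measurable_fun [set: T] (fun t => \1_[set t | nondeg t] t * xh t).
Proof.
have mA := measurable_nondeg.
apply: (@measurable_root _ _ _ _ (fun c t => p * lam0 * c `^ (p - q) * \1_T0 t
    + r * sigma t * c `^ (r - q)) (fun t => q * sabs (psi t) `^ q)) => //.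
- by apply: measurable_funM => //; exact: measurable_sabs_powR.
- move=> c; apply: measurable_funD.
    by apply: measurable_funM => //; exact: measurable_indic.
  apply: measurable_funM => //.
  by apply: measurable_funM => //; exact: measurable_sigma.
- by move=> t /xh_sol h; lra.
- move=> t a b /= nd a0 ab.
  have b0 : 0 <= b by rewrite (le_trans a0)// ltW.
  have P1 : a `^ (p - q) < b `^ (p - q).
    by apply: gt0_ltr_powR; rewrite ?subr_gt0// nnegrE.
  have R1 : a `^ (r - q) < b `^ (r - q).
    by apply: gt0_ltr_powR; rewrite ?subr_gt0// nnegrE.
  have l0 : 0 <= lam0 * \1_T0 t by rewrite mulr_ge0// indicE ler0n.
  (* If [sigma t] vanishes, the strict increase comes from the [lam0] term; otherwise it comes from
     the [sigma] term, and the other one is merely nondecreasing. *)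
  have := sigma_ge0 t; rewrite le_eqVlt => /predU1P[s0|s0].
    have l1 : 0 < lam0 * \1_T0 t.
      by rewrite lt_neqAle l0 andbT eq_sym; move: nd; rewrite -s0 addr0.
    rewrite -s0 mulr0 !mul0r !addr0 !(mulrAC (p * lam0) _ (\1_T0 t)) ltr_pM2l//.
    by rewrite -mulrA mulr_gt0.
  rewrite ler_ltD//.
    rewrite !(mulrAC (p * lam0) _ (\1_T0 t)) ler_wpM2l ?(ltW P1)//.
    by rewrite -mulrA mulr_ge0// ltW.
  by rewrite ltr_pM2l// mulr_gt0.
Qed.

(** The powers of [xh] are kept as separate factors, ready for [young_powR]. *)
Lemma mhat_convex (x y : T -> scalar_field R s) t : nondeg t ->
  sabs (psi t * x t - mhat T0 psi p q lam0 xh y t) `^ q <=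
  q^-1 * p * lam0 * (\1_T0 t * (xh t `^ (p - q) * sabs (x t - y t) `^ q))
  + q^-1 * r * (sigma t * (xh t `^ (r - q) * sabs (x t) `^ q)).
Proof.
move=> nd; have E := psi_split nd.
set P := q^-1 * p * lam0 * (\1_T0 t * xh t `^ (p - q)) in E.
set S := q^-1 * r * (sigma t * xh t `^ (r - q)) in E.
have P0 : 0 <= P by rewrite /P mulr_ge0// mulr_ge0 ?powR_ge0// indicE ler0n.
have S0 : 0 <= S by rewrite /S mulr_ge0// mulr_ge0 ?sigma_ge0 ?powR_ge0.
rewrite (_ : _ + _ = P * sabs (x t - y t) `^ q + S * sabs (x t) `^ q); last first.
  by rewrite /P /S !mulrA.
rewrite /mhat; case: ifPn => [/andP[tT0 psi0]|].
  set M := sabs (psi t) `^ q in E.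
  have M0 : 0 < M by rewrite powR_gt0// lt_neqAle sabs_ge0 andbT eq_sym sabs_eq0.
  have MN0 : M != 0 by rewrite gt_eqF.
  have PM : q^-1 * p * lam0 * xh t `^ (p - q) * sabs (psi t) `^ (- q) = P / M.
    by rewrite /P indicE tT0 mul1r powRN.
  rewrite PM; set c := P / M.
  have c0 : 0 <= c by rewrite divr_ge0// ltW.
  have c1 : c <= 1 by rewrite ler_pdivrMr// mul1r E lerDl.
  rewrite (_ : _ - _ = psi t * (sreal s (1 - c) * x t + sreal s c * (x t - y t))).
    rewrite sabsM powRM ?sabs_ge0// -/M.
    apply: (@le_trans _ _ (M * ((1 - c) * sabs (x t) `^ q + c * sabs (x t - y t) `^ q))).
      rewrite ler_pM2l//; apply: le_trans (@powR_convex_le _ c _ _ _ q_ge1 c0 c1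
        (sabs_ge0 _) (sabs_ge0 _)).
      apply: ge0_ler_powR; rewrite ?nnegrE ?sabs_ge0//; first exact: ltW.
        by rewrite addr_ge0// mulr_ge0// ?subr_ge0// sabs_ge0.
      apply: le_trans (sabsD _ _) _; rewrite !sabsM !sabs_real.
      by rewrite !ger0_norm// subr_ge0.
    (* Equality holds here: [M * c = P] and [M * (1 - c) = S]. *)
    rewrite le_eqVlt; apply/orP; left; apply/eqP.
    have -> : S = M - P by rewrite E addrC addKr.
    by rewrite /c; field.
  by rewrite srealB sreal1; ring.
(* Here [mhat] is 0. Off [T0] the term [P] vanishes and the bound is an equality; where [psi t = 0]
   the left side is 0. *)
rewrite negb_and negbK subr0 sabsM powRM ?sabs_ge0// => /orP[tT0|/eqP psi0].
  by rewrite E /P indicE (negbTE tT0) mul0r mulr0 mul0r !add0r.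
by rewrite psi0 sabs0 powR0 ?gt_eqF// mul0r addr_ge0// mulr_ge0// powR_ge0.
Qed.

(** Young's inequality is used with exponent [p] on the first term and with [r] inside each summand
    of [sigma]; [sabs (phi j t) ^ r] then recombines with the power of [x], giving the quantities
    that the constraints control. *)
Lemma mhat_young (x y : T -> scalar_field R s) t : nondeg t ->
  sabs (psi t * x t - mhat T0 psi p q lam0 xh y t) `^ q <=
  q^-1 * p * lam0 * (\1_T0 t * ((p - q) / p * xh t `^ p
                                + q / p * sabs (x t - y t) `^ p))
  + q^-1 * r * \sum_(j < n) lam j *
      ((r - q) / r * (sabs (phi j t) `^ r * xh t `^ r)
       + q / r * sabs (phi j t * x t) `^ r).
Proof.
move=> nd; apply: le_trans (mhat_convex x y nd) _; apply: lerD.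
  rewrite ler_wpM2l// ler_wpM2l ?indicE ?ler0n//.
  by apply: young_powR => //; exact: sabs_ge0.
rewrite ler_wpM2l// mulr_suml; apply: ler_sum => j _.
rewrite -mulrA ler_wpM2l// sabsM powRM ?sabs_ge0//.
rewrite !(mulrCA _ (sabs (phi j t) `^ r)) -mulrDr ler_wpM2l ?powR_ge0//.
by apply: young_powR => //; exact: sabs_ge0.
Qed.

(** This is the equality case of [mhat_young], at [x = xh] and [y = 0]: multiplying [psi_split] by
    [xh t ^ q] raises the exponents [p - q] and [r - q] to [p] and [r]. *)
Lemma psi_xh t : nondeg t ->
  sabs (psi t * sreal s (xh t)) `^ q =
  q^-1 * p * lam0 * (\1_T0 t * xh t `^ p)
  + q^-1 * r * \sum_(j < n) lam j * (sabs (phi j t) `^ r * xh t `^ r).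
Proof.
move=> nd; rewrite sabsM powRM ?sabs_ge0// sabs_real ger0_norm// (psi_split nd).
rewrite mulrDl -!mulrA !powRB_mul//; congr (_ + _ * (_ * _)).
by rewrite mulr_suml; apply: eq_bigr => j _; rewrite mulrA.
Qed.

Lemma measurable_mhat (y : T -> scalar_field R s) :
  measurable_fun [set: T] xh -> smeasurable y ->
  smeasurable (mhat T0 psi p q lam0 xh y).
Proof.
move=> mxh my.
(* The case distinction becomes a product: the indicator handles [T0], and the factor [psi t]
   already vanishes where the test on [psi] fails. *)
rewrite (_ : mhat _ _ _ _ _ _ _ = fun t => sreal s (\1_T0 t *
    (q^-1 * p * lam0 * xh t `^ (p - q) * sabs (psi t) `^ (- q))) * psi t * y t).
  apply: smeasurableM => //; apply: smeasurableM => //; apply: smeasurable_real.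
  apply: measurable_funM; first exact: measurable_indic.
  apply: measurable_funM; last exact: measurable_sabs_powR.
  by apply: measurable_funM => //; exact: measurable_powR_comp.
apply/funext => t; rewrite /mhat indicE; case: (t \in T0) => /=.
  rewrite mul1r; case: eqP => //= ->.
  by rewrite mulr0 mul0r.
by rewrite mul0r sreal0 !mul0r.
Qed.

(** * Integral estimates for measurable [xh] *)

Context (mxh : measurable_fun [set: T] xh)
  (nd_ae : {ae mu, forall t, nondeg t})
  (xh_p : (\int[mu]_(t in T0) (xh t `^ p)%:E <= (delta `^ p)%:E)%E)
  (xh_r : forall j,
     (\int[mu]_t (sabs (phi j t) `^ r * xh t `^ r)%:E <= 1)%E).

Let phi_xh_ge0 j t : 0 <= sabs (phi j t) `^ r * xh t `^ r.
Proof. by rewrite mulr_ge0// powR_ge0. Qed.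

Let measurable_phi_xh j :
  measurable_fun [set: T] (fun t => sabs (phi j t) `^ r * xh t `^ r).
Proof.
by apply: measurable_funM; [exact: measurable_sabs_powR|exact: measurable_powR_comp].
Qed.

(** The bounds [a] and [b] stay free for two uses: [a = delta ^ p], [b = 1] gives the error of
    [mhat], and [x = 0], [b = 0] shows that [mhat] takes values in L_q. *)
Lemma integral_mhat_le (x y : T -> scalar_field R s) (a b : R) :
  smeasurable x -> smeasurable y ->
  (\int[mu]_(t in T0) (sabs (x t - y t) `^ p)%:E <= a%:E)%E ->
  (forall j, \int[mu]_t (sabs (phi j t * x t) `^ r)%:E <= b%:E)%E ->
  (\int[mu]_t (sabs (psi t * x t - mhat T0 psi p q lam0 xh y t) `^ q)%:E <=
   (q^-1 * p * lam0 * ((p - q) / p * delta `^ p + q / p * a)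
    + q^-1 * r * \sum_(j < n) lam j * ((r - q) / r + q / r * b))%:E)%E.
Proof.
move=> mx my xya phixb.
have pq0 : 0 <= (p - q) / p by rewrite divr_ge0 ?subr_ge0 ?ltW.
have qp0 : 0 <= q / p by rewrite divr_ge0 ?ltW.
have rq0 : 0 <= (r - q) / r by rewrite divr_ge0 ?subr_ge0 ?ltW.
have qr0 : 0 <= q / r by rewrite divr_ge0 ?ltW.
pose G0 t := (p - q) / p * xh t `^ p + q / p * sabs (x t - y t) `^ p.
pose G j t := (r - q) / r * (sabs (phi j t) `^ r * xh t `^ r)
  + q / r * sabs (phi j t * x t) `^ r.
have mG0 D : measurable_fun D G0.
  apply: measurable_funD; apply: measurable_funM => //.
    exact: measurable_powR_comp.
  by apply: (@measurable_sabs_powR (fun t => x t - y t)); exact: smeasurableB.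
have mG j : measurable_fun [set: T] (G j).
  apply: measurable_funD; apply: measurable_funM => //.
  by apply: (@measurable_sabs_powR (fun t => phi j t * x t)); exact: smeasurableM.
have G0_ge0 t : 0 <= G0 t by rewrite addr_ge0// mulr_ge0// powR_ge0.
have G_ge0 j t : 0 <= G j t by rewrite addr_ge0// mulr_ge0// powR_ge0.
have mI : measurable_fun [set: T] (fun t => \1_T0 t * G0 t).
  by apply: measurable_funM => //; exact: measurable_indic.
have I_ge0 t : 0 <= \1_T0 t * G0 t by rewrite mulr_ge0// indicE ler0n.
have mS : measurable_fun [set: T] (fun t => \sum_(j < n) lam j * G j t).
  by apply: measurable_sum => j; exact: measurable_funM.
have S_ge0 t : 0 <= \sum_(j < n) lam j * G j t.
  by apply: sumr_ge0 => j _; rewrite mulr_ge0.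
(* The pointwise bound holds almost everywhere. Its right side is a nonnegative combination of
   measurable functions, so the integral splits into pieces bounded by [xh_p], [xh_r] and the two
   assumptions on [x] and [y]. *)
apply: (@le_trans _ _ (\int[mu]_t (q^-1 * p * lam0 * (\1_T0 t * G0 t)
    + q^-1 * r * \sum_(j < n) lam j * G j t)%:E)%E).
  apply: ae_ge0_le_integral => //.
  - by move=> t _; rewrite lee_fin powR_ge0.
  - apply/measurable_EFinP.
    apply: (@measurable_sabs_powR (fun t => _ - _)).
    by apply: smeasurableB; [exact: smeasurableM|exact: measurable_mhat].
  - by move=> t _; rewrite lee_fin addr_ge0// mulr_ge0.
  - by apply/measurable_EFinP; apply: measurable_funD; exact: measurable_funM.
  - by apply: filterS nd_ae => t nd _; rewrite lee_fin; exact: mhat_young.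
rewrite integralD_EFin//; last 4 first.
- exact: measurable_funM.
- exact: measurable_funM.
- by move=> t _; rewrite mulr_ge0.
- by move=> t _; rewrite mulr_ge0.
rewrite !integralZ_EFin// integral_indicM integral_sum_EFin// EFinD.
apply: leeD; rewrite [leRHS]EFinM; apply: lee_wpmul2l; rewrite ?lee_fin//.
- have mxp : measurable_fun T0 (fun t => xh t `^ p) by exact: measurable_powR_comp.
  have mxy : measurable_fun T0 (fun t => sabs (x t - y t) `^ p).
    by apply: (@measurable_sabs_powR (fun t => x t - y t)); exact: smeasurableB.
  have xp0 t : 0 <= xh t `^ p by exact: powR_ge0.
  have xy0 t : 0 <= sabs (x t - y t) `^ p by exact: powR_ge0.
  rewrite integralD_EFin//; last 4 first.
  + exact: measurable_funM.
  + exact: measurable_funM.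
  + by move=> t _; rewrite mulr_ge0.
  + by move=> t _; rewrite mulr_ge0.
  rewrite !integralZ_EFin//.
  by rewrite EFinD; apply: leeD; rewrite [leRHS]EFinM lee_wpmul2l// lee_fin.
- rewrite -sumEFin; apply: lee_sum => j _; rewrite [leRHS]EFinM.
  apply: lee_wpmul2l; rewrite ?lee_fin//.
  have mphix : measurable_fun [set: T] (fun t => sabs (phi j t * x t) `^ r).
    by apply: (@measurable_sabs_powR (fun t => phi j t * x t)); exact: smeasurableM.
  have phix0 t : 0 <= sabs (phi j t * x t) `^ r by exact: powR_ge0.
  rewrite integralD_EFin//; last 4 first.
  + exact: measurable_funM.
  + exact: measurable_funM.
  + by move=> t _; rewrite mulr_ge0.
  + by move=> t _; rewrite mulr_ge0.
  rewrite !integralZ_EFin// EFinD; apply: leeD.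
    by rewrite -[leRHS]mule1; apply: lee_wpmul2l; rewrite ?lee_fin.
  by rewrite [leRHS]EFinM; apply: lee_wpmul2l; rewrite ?lee_fin.
Qed.

Context
  (slack0 : (lam0%:E *
     (\int[mu]_(t in T0) (xh t `^ p)%:E - (delta `^ p)%:E) = 0)%E)
  (slack : forall j, ((lam j)%:E *
     (\int[mu]_t (sabs (phi j t) `^ r * xh t `^ r)%:E - 1) = 0)%E).

(** Complementary slackness enters here: after integrating [psi_xh], each multiplier times its
    integral equals the multiplier times the constraint bound. *)
Lemma integral_psi_xh :
  (\int[mu]_t (sabs (psi t * sreal s (xh t)) `^ q)%:E =
   (q^-1 * p * lam0 * delta `^ p + q^-1 * r * \sum_(j < n) lam j)%:E)%E.
Proof.
have mxp D : measurable_fun D (fun t => xh t `^ p) by exact: measurable_powR_comp.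
have mI : measurable_fun [set: T] (fun t => \1_T0 t * xh t `^ p).
  by apply: measurable_funM => //; exact: measurable_indic.
have I_ge0 t : 0 <= \1_T0 t * xh t `^ p by rewrite mulr_ge0 ?powR_ge0// indicE ler0n.
have mS : measurable_fun [set: T]
    (fun t => \sum_(j < n) lam j * (sabs (phi j t) `^ r * xh t `^ r)).
  by apply: measurable_sum => j; exact: measurable_funM.
have S_ge0 t : 0 <= \sum_(j < n) lam j * (sabs (phi j t) `^ r * xh t `^ r).
  by apply: sumr_ge0 => j _; rewrite mulr_ge0.
rewrite (ae_eq_integral (fun t => (q^-1 * p * lam0 * (\1_T0 t * xh t `^ p)
  + q^-1 * r * \sum_(j < n) lam j * (sabs (phi j t) `^ r * xh t `^ r))%:E))//; first last.
- by apply: filterS nd_ae => t nd _; rewrite psi_xh.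
- by apply/measurable_EFinP; apply: measurable_funD; exact: measurable_funM.
- apply/measurable_EFinP; apply: (@measurable_sabs_powR (fun t => _ * _)).
  by apply: smeasurableM => //; exact: smeasurable_real.
rewrite integralD_EFin//; last 4 first.
- exact: measurable_funM.
- exact: measurable_funM.
- by move=> t _; rewrite mulr_ge0.
- by move=> t _; rewrite mulr_ge0.
rewrite !integralZ_EFin// integral_indicM integral_sum_EFin// EFinD.
congr (_ + _)%E.
  rewrite EFinM -muleA (slack_mule _ xh_p slack0) ?EFinM ?muleA//.
  by apply: integral_ge0 => t _; rewrite lee_fin powR_ge0.
rewrite [RHS]EFinM -sumEFin; congr (_ * _)%E; apply: eq_bigr => j _.
rewrite (slack_mule _ (xh_r j) (slack j)) ?mulr1//.
by apply: integral_ge0 => t _; rewrite lee_fin.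
Qed.

(** * The error of [mhat] and the lower bound for every method *)

Local Notation value :=
  (q^-1 * p * lam0 * delta `^ p + q^-1 * r * \sum_(j < n) lam j).

Let value_ge0 : 0 <= value.
Proof. by rewrite addr_ge0// mulr_ge0 ?powR_ge0// sumr_ge0. Qed.

Lemma mhat_method : recovery_method mu T0 p q (mhat T0 psi p q lam0 xh).
Proof.
move=> y [my _ yp]; split => //.
- exact: measurable_mhat.
- by move=> t; case.
have := yp; rewrite !Lpnorm_lty// => {}yp.
have I0 : (0 <= \int[mu]_(t in T0) (sabs (y t) `^ p)%:E)%E.
  by apply: integral_ge0 => t _; rewrite lee_fin powR_ge0.
(* With [x = 0] the error is [mhat y] up to sign, and the finite norm of [y] supplies the bound
   [a]. *)
have := @integral_mhat_le (fun=> 0) y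
  (fine (\int[mu]_(t in T0) (sabs (y t) `^ p)%:E)) 0 smeasurable0 my.
under eq_integral do rewrite sub0r sabsN.
under [X in _ -> _ -> (X <= _)%E]eq_integral do rewrite mulr0 sub0r sabsN.
move=> h; apply: le_lt_trans (h _ _) (ltry _).
- by rewrite fineK// ge0_fin_numE.
- by move=> j; under eq_integral do rewrite mulr0 sabs0 powR0 ?gt_eqF//; rewrite integral0.
Qed.

Lemma mhat_error_le :
  (recovery_error mu T0 psi phi delta p q r (mhat T0 psi p q lam0 xh) <=
   (value `^ q^-1)%:E)%E.
Proof.
apply: ge_ereal_sup => _ [x [y [[[mx _ _] xW] [my _ _] xy ->]]].
rewrite Lpnorm_le ?powR_ge0// -powRrM mulVf ?gt_eqF// powRr1//.
(* The Young weights [(p - q) / p] and [q / p] add up to 1, as do those for [r], so for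
   [a = delta ^ p] and [b = 1] the integral bound is exactly [value]. *)
have -> : value = q^-1 * p * lam0 * ((p - q) / p * delta `^ p + q / p * delta `^ p)
    + q^-1 * r * \sum_(j < n) lam j * ((r - q) / r + q / r * 1).
  rewrite -mulrDl -mulrDl subrK divff ?gt_eqF// mul1r.
  congr (_ + _ * _); apply: eq_bigr => j _.
  by rewrite mulr1 -mulrDl subrK divff ?mulr1// gt_eqF.
apply: integral_mhat_le => //.
- by rewrite -Lpnorm_le// ltW.
- by move=> j; have := xW j; rewrite (Lpnorm_le _ _ _ _ (c := 1))// powR1.
Qed.

(** The boolean encodes the sign, so that [xh] and its negative are treated together. *)
Lemma W_solution (b : bool) :
  W mu T0 phi p r (fun t => sreal s ((-1) ^+ b * xh t)).
Proof.
have mx : smeasurable (fun t => sreal s ((-1) ^+ b * xh t)).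
  by apply: smeasurable_real; exact: measurable_funM.
have xE t : sabs (sreal s ((-1) ^+ b * xh t)) = xh t.
  by rewrite sabs_real normrM normr_sign mul1r ger0_norm.
have xW j : (Lpnorm mu setT r
    (fun t => phi j t * sreal s ((-1) ^+ b * xh t))%R <= 1)%E.
  rewrite (Lpnorm_le _ _ _ _ (c := 1))// powR1.
  by under eq_integral do rewrite sabsM xE powRM ?sabs_ge0//.
split=> //; split => //.
- split.
  + rewrite patch_sreal; apply: smeasurableM => //.
    by apply: smeasurable_real; exact: measurable_indic.
  + by move=> t /= tT0; rewrite patchE memNset.
  + rewrite Lpnorm_lty//; apply: le_lt_trans (ltry (delta `^ p)).
    apply: le_trans xh_p; rewrite le_eqVlt; apply/orP; left; apply/eqP.
    by apply: eq_integral => t tT0; rewrite patchE tT0 xE.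
- by move=> j; apply: le_lt_trans (xW j) (ltry _).
Qed.

Lemma recovery_error_ge m : recovery_method mu T0 p q m ->
  ((value `^ q^-1)%:E <= recovery_error mu T0 psi phi delta p q r m)%E.
Proof.
move=> mm; set E := recovery_error _ _ _ _ _ _ _ _ _.
pose x (b : bool) t := sreal s ((-1) ^+ b * xh t).
pose y0 : T -> scalar_field R s := fun=> 0.
have y0L : Lp mu T0 p y0.
  split=> //; first exact: smeasurable0.
  rewrite Lpnorm_lty//; under eq_integral do rewrite sabs0 powR0 ?gt_eqF//.
  by rewrite integral0.
have [mm0 _ _] := mm _ y0L.
have mx b : smeasurable (x b).
  by apply: smeasurable_real; exact: measurable_funM.
have le_E b : (Lpnorm mu [set: T] q (fun t => Lambda psi (x b) t - m y0 t)%R <= E)%E.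
  apply: ereal_sup_ubound; exists (x b), y0; split => //; first exact: W_solution.
  rewrite Lpnorm_le ?(ltW delta_gt0)//; apply: le_trans xh_p.
  rewrite le_eqVlt; apply/orP; left; apply/eqP; apply: eq_integral => t _.
  by rewrite subr0 sabs_real normrM normr_sign mul1r ger0_norm.
(* An infinite error leaves nothing to prove, and minus infinity is excluded by nonnegativity of the
   norm; a real [c] allows passing to integrals. *)
case: E le_E => [c| |] le_E; last 2 first.
- exact: leey.
- by have := le_trans (Lpnorm_ge0 _ _ _ _) (le_E true).
have c0 : 0 <= c by rewrite -lee_fin; exact: le_trans (Lpnorm_ge0 _ _ _ _) (le_E true).
have {}le_E b : (\int[mu]_t (sabs (psi t * x b t - m y0 t) `^ q)%:E <= (c `^ q)%:E)%E.
  by have := le_E b; rewrite Lpnorm_le.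
have mf b : measurable_fun [set: T] (fun t => sabs (psi t * x b t - m y0 t) `^ q).
  apply: (@measurable_sabs_powR (fun t => _ - _)).
  by apply: smeasurableB => //; exact: smeasurableM.
have f0 b t : 0 <= sabs (psi t * x b t - m y0 t) `^ q by exact: powR_ge0.
have half0 : 0 <= 2^-1 :> R by rewrite invr_ge0.
have : (value%:E <= (c `^ q)%:E)%E.
  rewrite -integral_psi_xh.
  (* [psi * xh] is half the difference of the two errors, since [m y0] cancels; convexity with
     weight 1/2 bounds its [q]-th power by the average of theirs. *)
  apply: (@le_trans _ _ (\int[mu]_t (2^-1 * sabs (psi t * x false t - m y0 t) `^ q
      + 2^-1 * sabs (psi t * x true t - m y0 t) `^ q)%:E)%E).
    apply: ge0_le_integral => //.
    - by move=> t _; rewrite lee_fin powR_ge0.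
    - apply/measurable_EFinP; apply: (@measurable_sabs_powR (fun t => _ * _)).
      by apply: smeasurableM => //; exact: smeasurable_real.
    - by apply/measurable_EFinP; apply: measurable_funD; exact: measurable_funM.
    move=> t _; rewrite lee_fin.
    have half1 : 1 - 2^-1 = 2^-1 :> R by lra.
    have h := @powR_convex_le R 2^-1 (sabs (psi t * x false t - m y0 t))
      (sabs (psi t * x true t - m y0 t)) q q_ge1 half0.
    rewrite half1 in h; apply: le_trans (h _ (sabs_ge0 _) (sabs_ge0 _)); last by lra.
    apply: ge0_ler_powR; rewrite ?nnegrE ?sabs_ge0//; first exact: ltW.
      by rewrite addr_ge0// mulr_ge0// sabs_ge0.
    rewrite -mulrDr.
    rewrite (_ : psi t * _ = sreal s 2^-1 *
        ((psi t * x false t - m y0 t) - (psi t * x true t - m y0 t))).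
      rewrite sabsM sabs_real ger0_norm// ler_wpM2l//; exact: sabsB.
    have -> : x false t = sreal s (xh t) by rewrite /x expr0 mul1r.
    have -> : x true t = - sreal s (xh t).
      by rewrite /x expr1 mulN1r -sub0r srealB sreal0 sub0r.
    have H2 : sreal s (2^-1 : R) + sreal s 2^-1 = 1.
      by rewrite -{1}half1 srealB sreal1 subrK.
    by rewrite -[LHS]mul1r -H2; ring.
  rewrite integralD_EFin//; last 4 first.
  - exact: measurable_funM.
  - exact: measurable_funM.
  - by move=> t _; rewrite mulr_ge0.
  - by move=> t _; rewrite mulr_ge0.
  rewrite !integralZ_EFin//.
  rewrite (_ : c `^ q = 2^-1 * c `^ q + 2^-1 * c `^ q); last by lra.
  by rewrite EFinD; apply: leeD; rewrite [leRHS]EFinM lee_wpmul2l// lee_fin.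
rewrite !lee_fin => vc.
(* Writing [c] as the [q]-th root of [c ^ q] reduces the claim to monotonicity of the root. *)
rewrite -[leRHS]powRr1// -(mulfV (lt0r_neq0 q_gt0)) powRrM.
by apply: ge0_ler_powR; rewrite ?nnegrE ?powR_ge0 ?invr_ge0 ?(ltW q_gt0).
Qed.

Lemma measurable_optimal_recovery :
  optimal_error mu T0 psi phi delta p q r = (value `^ q^-1)%:E /\
  optimal_method mu T0 psi phi delta p q r (mhat T0 psi p q lam0 xh).
Proof.
have hE : optimal_error mu T0 psi phi delta p q r = (value `^ q^-1)%:E.
  apply/eqP; rewrite eq_le; apply/andP; split.
    apply: le_trans mhat_error_le; apply: ereal_inf_lbound.
    by exists (mhat T0 psi p q lam0 xh) => //; exact: mhat_method.
  by apply: le_ereal_inf_tmp => _ [m mm <-]; exact: recovery_error_ge.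
split=> //; split; first exact: mhat_method.
rewrite hE; apply/eqP; rewrite eq_le mhat_error_le/=.
exact/recovery_error_ge/mhat_method.
Qed.

End recovery.

(** * Reduction to a measurable solution *)

Theorem theorem1 (d : measure_display) (T : measurableType d) (R : realType)
    (s : scalar_kind) (mu : {measure set T -> \bar R})
    (T0 : set T) (mT0 : measurable T0) (T0_neq0 : T0 !=set0)
    (n : nat) (psi : T -> scalar_field R s) (phi : 'I_n -> T -> scalar_field R s)
    (mpsi : smeasurable psi) (mphi : forall j, smeasurable (phi j))
    (delta : R) (delta_gt0 : 0 < delta)
    (p q r : R) (q_ge1 : 1 <= q) (qp : q < p) (qr : q < r)
    (Lambda_Lq : forall x, calW mu T0 phi p r x ->
       Lp mu [set: T] q (Lambda psi x))
    (lam0 : R) (lam : 'I_n -> R)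
    (lam0_ge0 : 0 <= lam0) (lam_ge0 : forall j, 0 <= lam j)
    (nondeg_in : {ae mu, forall t, T0 t -> lam0 + sigma_r phi r lam t != 0})
    (nondeg_out : {ae mu, forall t, ~ T0 t -> sigma_r phi r lam t != 0})
    (xh : T -> R) (xh_ge0 : forall t, 0 <= xh t)
    (xh_sol : forall t, lam0 * \1_T0 t + sigma_r phi r lam t != 0 ->
       - q * sabs (psi t) `^ q + p * lam0 * xh t `^ (p - q) * \1_T0 t
         + r * sigma_r phi r lam t * xh t `^ (r - q) = 0)
    (xh_p : (\int[mu]_(t in T0) (xh t `^ p)%:E <= (delta `^ p)%:E)%E)
    (xh_r : forall j,
       (\int[mu]_t (sabs (phi j t) `^ r * xh t `^ r)%:E <= 1)%E)
    (slack0 : (lam0%:E *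
       (\int[mu]_(t in T0) (xh t `^ p)%:E - (delta `^ p)%:E) = 0)%E)
    (slack : forall j, ((lam j)%:E *
       (\int[mu]_t (sabs (phi j t) `^ r * xh t `^ r)%:E - 1) = 0)%E) :
  optimal_error mu T0 psi phi delta p q r =
    ((q^-1 * p * lam0 * delta `^ p + q^-1 * r * \sum_(j < n) lam j)
       `^ q^-1)%:E /\
  optimal_method mu T0 psi phi delta p q r (mhat T0 psi p q lam0 xh).
Proof.
pose A := [set t | lam0 * \1_T0 t + sigma_r phi r lam t != 0].
have mA : measurable A by exact: measurable_nondeg.
have nd_ae : {ae mu, forall t, lam0 * \1_T0 t + sigma_r phi r lam t != 0}.
  apply: filterS2 nondeg_in nondeg_out => t; rewrite indicE.
  case: (boolP (t \in T0)) => [/set_mem tT0 /(_ tT0)|].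
    by rewrite mulr1.
  by move=> /negP; rewrite in_setE mulr0 add0r => tT0 _ /(_ tT0).
have muA : mu (~` A) = 0%E by apply/negligibleP => //; exact: measurableC.
(* Cut off to the conull set [A], the solution is measurable by [measurable_solution], and
   [eq_integral_conull] preserves the integral conditions. *)
pose x t := \1_A t * xh t.
have x_ge0 t : 0 <= x t by rewrite mulr_ge0// indicE ler0n.
have xE t : A t -> x t = xh t by move=> At; rewrite /x indicE mem_set// mul1r.
have mx : measurable_fun [set: T] x by exact: measurable_solution xh_sol.
have x_p : (\int[mu]_(t in T0) (xh t `^ p)%:E =
    \int[mu]_(t in T0) (x t `^ p)%:E)%E.
  apply: (eq_integral_conull _ mA muA) => t; rewrite ?lee_fin ?powR_ge0//.
  by move=> /xE ->.
have x_r j : (\int[mu]_t (sabs (phi j t) `^ r * xh t `^ r)%:E =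
    \int[mu]_t (sabs (phi j t) `^ r * x t `^ r)%:E)%E.
  apply: (eq_integral_conull _ mA muA) => t;
    rewrite ?lee_fin ?mulr_ge0 ?powR_ge0//.
  by move=> /xE ->.
have -> : mhat T0 psi p q lam0 xh = mhat T0 psi p q lam0 x.
  apply/funext => y; apply/funext => t; rewrite /mhat.
  case: ifP => // /andP[tT0 _].
  (* At a degenerate point of [T0] the sum of the nonnegative numbers [lam0] and
     [sigma_r phi r lam t] is 0, so [lam0 = 0] and both versions of [mhat] vanish. *)
  have [/xE ->//|/negP/negPn] := pselect (A t).
  rewrite indicE tT0 mulr1 paddr_eq0 ?(sigma_ge0 phi r lam_ge0)//.
  by move=> /andP[/eqP -> _]; rewrite mulr0 !mul0r.
apply: measurable_optimal_recovery => //.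
- by move=> t nd; rewrite xE//; exact: xh_sol.
- by rewrite -x_p.
- by move=> j; rewrite -x_r.
- by rewrite -x_p.
- by move=> j; rewrite -x_r.
Qed.
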